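(* Let $S$ be a finite set of points in $\mathbb{R}^d$ and let $z \in \mathbb{R}^d$ be in general position with respect to $S$ (so $z \notin S$). Then: (a1) if either $S$ is $z$-avoiding, or $S$ is $z$-containing and $|S| = d+1$, then $|\mathcal{A}(S)| = d\,|\mathcal{C}(S)| + 1$; (a2) $|\mathcal{A}(S)| \le d\,|\mathcal{C}(S)| + 1$; (a3) if $S$ is $z$-containing and $|S| = d+2$, then $|\mathcal{A}(S)| = d\,|\mathcal{C}(S)| - d + 1$; (a4) if $S$ is $z$-containing and $|S| \ge d+3$, then $|\mathcal{A}(S)| \le d\,|\mathcal{C}(S)| - d$.
   Context: For $X \subseteq S$, $\mathrm{conv}(X)$ is the convex hull and $R(X)$ the smallest affine subspace containing $X$. A set $X \subseteq S$ is $z$-containing if $z$ lies in the interior of $\mathrm{conv}(X)$, and $z$-avoiding otherwise. $\mathcal{C}(S)$ is the set of minimal (under inclusion) $z$-containing subsets of $S$, and $\mathcal{A}(S)$ is the set of maximal (under inclusion, among subsets of $S$) $z$-avoiding subsets of $S$. The point $z$ is in general position with respect to $S$ if for every $X \subseteq S$ with $\dim R(X) < d$ we have $z \notin R(X)$. *)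

(* Defs.v *)
From HB Require Import structures.
From mathcomp Require Import all_boot all_order all_algebra finmap.
From mathcomp Require Import all_classical all_reals all_analysis.

Set Implicit Arguments.
Unset Strict Implicit.
Unset Printing Implicit Defensive.

Import Order.TTheory GRing.Theory Num.Theory.
Import numFieldNormedType.Exports.

Local Open Scope classical_set_scope.
Local Open Scope ring_scope.

Section ZContaining.
Variables (R : realType) (d : nat).
Implicit Types (A : set 'rV[R]_d) (X S : {fset 'rV[R]_d}) (z : 'rV[R]_d).

Definition conv_hull A : set 'rV[R]_d := smallest (@convex_set R 'rV[R]_d) A.

Definition translate (p : 'rV[R]_d) (V : {vspace 'rV[R]_d}) : set 'rV[R]_d :=
  [set p + v | v in [set` V]].

(* The empty set counts as an affine subspace, so that the smallest affine
   subspace containing the empty set is empty. *)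
Definition affine_subspace A : Prop :=
  A = set0 \/ exists p V, A = translate p V.

Definition affine_hull A : set 'rV[R]_d := smallest affine_subspace A.

(* Only meaningful on a nonempty affine subspace, where the witness [V] is
   unique; the default value 0 is junk. *)
Definition direction A : {vspace 'rV[R]_d} :=
  xget 0%VS [set V | exists p, A = translate p V].

(* The empty affine subspace has dimension -1. *)
Definition affine_dim A : int :=
  if `[< A = set0 >] then -1 else (\dim (direction A))%:Z.

Definition general_position z S : Prop :=
  forall X, (X `<=` S)%fset -> affine_dim (affine_hull [set` X]) < d%:Z ->
    ~ affine_hull [set` X] z.

Definition z_containing z X : Prop := interior (conv_hull [set` X]) z.

Definition z_avoiding z X : Prop := ~ z_containing z X.

Definition min_containing z S : {fset {fset 'rV[R]_d}} :=
  [fset X in fpowerset S |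
    `[< z_containing z X /\
        forall Y : {fset 'rV[R]_d}, (Y `<` X)%fset -> ~ z_containing z Y >]]%fset.

Definition max_avoiding z S : {fset {fset 'rV[R]_d}} :=
  [fset X in fpowerset S |
    `[< z_avoiding z X /\
        forall Y : {fset 'rV[R]_d},
          (Y `<=` S)%fset -> (X `<` Y)%fset -> ~ z_avoiding z Y >]]%fset.

End ZContaining.

(* Main.v *)
Require Import Defs.
From HB Require Import structures.
From mathcomp Require Import all_boot all_order all_algebra zify.
Set Implicit Arguments.
Unset Strict Implicit.
Unset Printing Implicit Defensive.

(** Lift each point [x] to [(1, x)]; by general position [z] is in the interior
    of [conv X] as soon as it is in [conv X], and minimal containing sets are
    simplices with [d + 1] vertices, whose lifts form a basis.

    Let [X] be a maximal avoiding subset of [U] and [t] a point of [U] outside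
    [X]. Among the simplices contained in [t |: X], choose the one, [C], giving
    the least weight to [t] in the expression of [z]. Minimality forces the
    hyperplane spanned by [C :\ t] to separate [X] from [z], and then maximality
    of [X] says that [X] consists of all the points of [U] on the far side. So
    [X] is determined by the pair [(C, t)]. Counting pairs shows that removing a
    point [i] from [U] lowers the number of maximal avoiding sets by at most [d]
    times the number of simplices through [i]. Inequality (a2) follows by
    induction from the empty set, and (a4) by induction from [|U| = d + 3]. In
    that case the complements of the simplices form a 2-regular graph, because a
    simplex [C] and a point [s] outside it determine a unique [c] in [C] that
    can be exchanged for [s]; this exchange property also gives (a3). *)

(** * Counting *)

Section Counting.
Variables (T : finType) (d : nat) (con : pred {set T}).
Variable opposite_side : {set T} -> T -> {set T}.
Implicit Types (U X Y C : {set T}).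

Definition simplices U := [set C : {set T} | [&& C \subset U, con C & #|C| == d.+1]].
Definition avoiders U :=
  [set X : {set T} | [&& X \subset U, ~~ con X & [forall s in U :\: X, con (s |: X)]]].

Hypothesis conS : forall A B : {set T}, A \subset B -> con A -> con B.
Hypothesis con_simplex : forall U, con U -> exists C, C \in simplices U.
Hypothesis pivot : forall C s, con C -> #|C| = d.+1 -> s \notin C ->
  exists2 c, c \in C & forall c', c' \in C -> con (s |: C :\ c') = (c' == c).
Hypothesis avoiders_opposite_side : forall U X t, X \in avoiders U -> t \in U :\: X ->
  exists C, [/\ t \in C, C \in simplices (t |: X) & X = U :&: opposite_side C t].

(** * Maximal avoiding sets and the deletion of a point *)

Lemma simplicesP U C :
  reflect [/\ C \subset U, con C & #|C| = d.+1] (C \in simplices U).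
Proof. by rewrite inE; apply: (iffP and3P) => -[? ? /eqP ?]. Qed.

Lemma avoidersP U X :
  reflect [/\ X \subset U, ~~ con X & forall s, s \in U -> s \notin X -> con (s |: X)]
          (X \in avoiders U).
Proof.
rewrite inE; apply: (iffP and3P) => -[? ? H]; split=> //.
  by move=> s sU sX; apply: (forall_inP H); rewrite inE sX.
by apply/forall_inP => s /setDP[]; apply: H.
Qed.

Lemma con_card U : con U -> d < #|U|.
Proof.
by move=> /con_simplex[C /simplicesP[CU _ <-]]; apply: subset_leq_card.
Qed.

Lemma avoiders_antichain U X Y :
  X \in avoiders U -> Y \in avoiders U -> X \subset Y -> X = Y.
Proof.
move=> /avoidersP[_ _ Xmax] /avoidersP[YU Yav _] XY.
apply/eqP; rewrite eqEsubset XY; apply/subsetP => y yY; apply/negPn/negP => yX.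
case/negP: Yav; apply: conS (Xmax _ (subsetP YU _ yY) yX).
by rewrite subUset sub1set yY.
Qed.

(** Equal traces make the two sets nested, and maximal avoiding sets form an antichain. This gives
    the injectivity of the trace map when a point is deleted. *)
Lemma avoiders_eqD1 U X Y i :
  X \in avoiders U -> Y \in avoiders U -> X :\ i = Y :\ i -> X = Y.
Proof.
move=> XA YA XY; have XYE k : k != i -> (k \in X) = (k \in Y).
  by move=> ki; move/setP: XY => /(_ k); rewrite !inE ki.
have [iY|iY] := boolP (i \in Y).
  apply: (avoiders_antichain XA YA); apply/subsetP => k.
  by have [->|/XYE->] := eqVneq k i.
apply/esym; apply: (avoiders_antichain YA XA); apply/subsetP => k.
by have [->|/XYE->] := eqVneq k i; first by rewrite (negPf iY).
Qed.

Lemma card_simplicesD1 U i :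
  #|simplices U| = #|simplices (U :\ i)| + #|[set C in simplices U | i \in C]|.
Proof.
rewrite -(cardsID [set C : {set T} | i \notin C] (simplices U)); congr (_ + _).
  apply: eq_card => C; rewrite !inE subsetD1.
  by case: (C \subset U); case: (con C); case: (i \in C); rewrite ?andbF ?andbT.
by apply: eq_card => C; rewrite !inE negbK andbC.
Qed.

Lemma card_flags (Q : {set {set T}}) (F : {set T} -> {set T}) k :
  (forall C, C \in Q -> #|F C| = k) ->
  #|[set p : {set T} * T | (p.1 \in Q) && (p.2 \in F p.1)]| = #|Q| * k.
Proof.
move=> Fk; rewrite -sum_nat_const -(eq_bigr _ Fk) -sum1_card.
under [RHS]eq_bigr do rewrite -sum1_card.
by rewrite pair_big_dep; apply: eq_bigl => p; rewrite inE.
Qed.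

(* A maximal avoiding [X] containing [i] whose trace [X :\ i] is not maximal in
   [U :\ i] determines, for a point [t] that can be added to the trace, a
   simplex through [t] and [i]; conversely the pair recovers [X]. *)
Lemma card_avoidersD1 U i : i \in U ->
  #|avoiders U| + d * #|simplices (U :\ i)| <=
  #|avoiders (U :\ i)| + d * #|simplices U|.
Proof.
move=> iU; rewrite (card_simplicesD1 U i); set Q := [set C in _ | _].
suff: #|avoiders U| <= #|avoiders (U :\ i)| + d * #|Q| by lia.
(* [L] collects the sets whose trace stays maximal, counted injectively by their traces. The others
   come from the pairs in [P] below, [d] for each simplex through [i]. *)
pose L := [set X in avoiders U | X :\ i \in avoiders (U :\ i)].
rewrite -(cardsID L (avoiders U)); apply: leq_add.
  rewrite -(@card_in_imset _ _ (fun X => X :\ i)).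
    apply: subset_leq_card; apply/subsetP => Y /imsetP[X /setIP[_ XL] ->].
    by move: XL; rewrite inE => /andP[].
  by move=> X Y /setIP[XA _] /setIP[YA _]; exact: avoiders_eqD1 XA YA.
pose P := [set p : {set T} * T | (p.1 \in Q) && (p.2 \in p.1 :\ i)].
have <- : #|P| = d * #|Q|.
  rewrite mulnC; apply: (@card_flags Q (fun C => C :\ i)) => C; rewrite inE => /andP[/simplicesP[_ _ cC] iC].
  by move: (cardsD1 i C); rewrite iC cC => -[].
apply: leq_trans (leq_imset_card (fun p => U :&: opposite_side p.1 p.2) (mem P)).
apply: subset_leq_card; apply/subsetP => X /setDP[XA].
rewrite inE XA /= => XiA; have [XU Xav Xmax] := avoidersP _ _ XA.
have Xiav : ~~ con (X :\ i) by apply: contra Xav; apply: conS; apply: subsetDl.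
have [iX|iX] := boolP (i \in X); last first.
  case/negP: XiA; apply/avoidersP; rewrite (setDidPl _) ?disjoints1 //; last first.
    by rewrite disjoint_sym disjoints1.
  split=> //; first by rewrite subsetD1 XU.
  by move=> s /setD1P[_ sU]; apply: Xmax.
have [t [tU tX tav]] : exists t, [/\ t \in U, t \notin X & ~~ con (t |: X :\ i)].
  move: XiA; rewrite inE setSD // Xiav /= => /forall_inPn[t /setDP[/setD1P[ti tU]]].
  by rewrite !inE ti /= => tX tav; exists t.
have [|C [tC /simplicesP[CX Ccon cC] XE]] := avoiders_opposite_side XA (t := t).
  by rewrite inE tX.
apply/imsetP; exists (C, t) => //=; rewrite !inE /= tC Ccon cC eqxx andbT.
rewrite (subset_trans CX) ?subUset ?sub1set ?tU //=.
have -> : t != i by apply: contraNneq tX => ->.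
rewrite andbT; apply: contraNT tav => iC; apply: conS Ccon.
apply/subsetP => c cC'; have := subsetP CX _ cC'; rewrite !inE.
by have [ci|] := eqVneq c i; first by rewrite -ci cC' in iC.
Qed.

Lemma avoiding_counts U : ~~ con U -> #|avoiders U| = 1 /\ #|simplices U| = 0.
Proof.
move=> Uav; split.
  apply/eqP/cards1P; exists U; apply/setP => X; rewrite [RHS]inE.
  apply/avoidersP/eqP => [[XU _ Xmax]|->].
    apply/eqP; rewrite eqEsubset XU; apply/subsetP => s sU; apply/negPn/negP => sX.
    case/negP: Uav; apply: conS (Xmax _ sU sX).
    by rewrite subUset sub1set sU.
  by split=> // s sU; rewrite sU.
apply: eq_card0 => C; apply/simplicesP => -[CU Ccon _].
by case/negP: Uav; apply: conS Ccon.
Qed.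

Lemma card_avoiders_le U : #|avoiders U| <= d * #|simplices U| + 1.
Proof.
elim: {U}#|U| {-2}U (erefl #|U|) => [|n IHn] U cU.
  have [|-> ->] := @avoiding_counts U; last by rewrite muln0.
  by apply/negP => /con_card; rewrite cU.
have [i iU] : exists i, i \in U by apply/card_gt0P; rewrite cU.
have := card_avoidersD1 iU; have := IHn (U :\ i).
have := cardsD1 i U; rewrite iU cU; lia.
Qed.

(** * Exact counts for [d + 1] and [d + 2] points *)

Lemma simplex_counts U : con U -> #|U| = d.+1 ->
  #|avoiders U| = d.+1 /\ #|simplices U| = 1.
Proof.
move=> Ucon cU.
have smallav X : #|X| <= d -> ~~ con X.
  by move=> cX; apply/negP => /con_card; rewrite ltnNge cX.
have cUx x : x \in U -> #|U :\ x| = d.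
  by move=> xU; move: (cardsD1 x U); rewrite xU cU => -[].
split; last first.
  apply/eqP/cards1P; exists U; apply/setP => C; rewrite [RHS]inE.
  apply/simplicesP/eqP => [[CU _ cC]|->] //.
  by apply/eqP; rewrite eqEcard CU cU cC /=.
rewrite -cU -(@card_in_imset _ _ (fun x => U :\ x) (mem U)).
  apply: eq_card => X; apply/avoidersP/imsetP => [[XU Xav Xmax]|[x xU ->]].
    have [x xU xX] : exists2 x, x \in U & x \notin X.
      by apply/subsetPn; apply: contra Xav => UX; apply: conS UX Ucon.
    exists x => //; apply/eqP; rewrite eqEsubset subsetD1 XU xX.
    apply/subsetP => y /setD1P[yx yU]; apply/negPn/negP => yX.
    have := con_card (Xmax _ xU xX); rewrite cardsU1 xX ltnS.
    suff: #|X| < d by lia.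
    rewrite -(cUx x xU); apply: proper_card; apply/properP.
    by split; [rewrite subsetD1 XU|exists y; rewrite // !inE yx].
  split; [exact: subsetDl| by rewrite smallav ?cUx|].
  by move=> s sU; rewrite !inE sU andbT negbK => /eqP->; rewrite setD1K.
by move=> x y xU yU /setP/(_ x); rewrite !inE eqxx xU !andbT => /esym/negbFE/eqP.
Qed.

(** A simplex [C] in [U] leaves out one point [s], with exchange partner [c] in [C]. Deleting [s]
    leaves [C], deleting [c] leaves the exchanged simplex, and uniqueness of the exchange excludes
    any other point. *)
Lemma two_simplices U : con U -> #|U| = d.+2 ->
  exists p q, [/\ p \in U, q \in U, p != q &
    forall x, x \in U -> con (U :\ x) = (x \in [set p; q])].
Proof.
move=> Ucon cU; have [C /simplicesP[CU Ccon cC]] := con_simplex Ucon.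
have [s sU sC] : exists2 s, s \in U & s \notin C.
  by apply/subsetPn/negP => /subset_leq_card; rewrite cU cC ltnn.
have UE : U = s |: C.
  apply/esym/eqP; rewrite eqEcard subUset sub1set sU CU cardsU1 sC cU cC /=.
  by rewrite add1n.
have [c cC' cP] := pivot Ccon cC sC.
have sc : s != c by apply: contraNneq sC => ->.
exists s, c; split; rewrite // ?(subsetP CU) // => x.
rewrite {1}UE !inE; have [->|xs] /= := eqVneq x s.
  by rewrite UE setU1K.
by move=> xC; rewrite -(cP x xC) UE setDUl [[set s] :\ x](setDidPl _) // disjoints1 inE eq_sym.
Qed.

Lemma simplicesD1 U C : #|U| = d.+2 ->
  (C \in simplices U) = [exists x in U, con (U :\ x) && (C == U :\ x)].
Proof.
move=> cU; apply/simplicesP/exists_inP => [[CU Ccon cC]|[x xU /andP[xcon /eqP->]]].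
  have /cards1P[x Ux] : #|U :\: C| == 1 by rewrite cardsDS // cU cC subSnn.
  have xU : x \in U by move/setP: Ux => /(_ x); rewrite !inE eqxx => /andP[].
  have CE : C = U :\ x by rewrite -Ux setDDr setDv set0U (setIidPr CU).
  by exists x; rewrite // -CE Ccon /=.
split; rewrite ?subsetDl //; have := cardsD1 x U; rewrite xU cU; lia.
Qed.

Lemma card_simplices2 U : con U -> #|U| = d.+2 -> #|simplices U| = 2.
Proof.
move=> Ucon cU; have [p [q [pU qU pq pqP]]] := two_simplices Ucon cU.
transitivity #|[set U :\ p; U :\ q]|.
  apply: eq_card => C; rewrite simplicesD1 // !inE.
  apply/exists_inP/orP => [[x xU]|].
    by rewrite pqP // !inE => /andP[/orP[]/eqP-> ?]; [left|right].
  by case=> /eqP->; [exists p|exists q]; rewrite ?pqP ?pU ?qU ?set21 ?set22 ?eqxx.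
rewrite cards2; suff -> : U :\ p != U :\ q by [].
by apply/eqP => /setP/(_ p); rewrite !inE eqxx pU pq.
Qed.

(** With [p] and [q] the two deletable points, the maximal avoiding sets are [U :\ x] for the [d]
    other points [x], and the set [V] of these points, which becomes containing once [p] or [q] is
    added. *)
Lemma card_avoiders2 U : con U -> #|U| = d.+2 -> #|avoiders U| = d.+1.
Proof.
move=> Ucon cU; have [p [q [pU qU pq pqP]]] := two_simplices Ucon cU.
pose V := U :\: [set p; q].
have cV : #|V| = d by rewrite cardsDS ?subUset ?sub1set ?pU // cU cards2 pq subn2.
transitivity #|V |: [set U :\ x | x in V]|.
  apply: eq_card => X; rewrite [RHS]in_setU1.
  apply/avoidersP/orP => [[XU Xav Xmax]|[/eqP->|/imsetP[x /setDP[xU xpq]] ->]].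
  - have [VX|/subsetPn[x xV xX]] := boolP (V \subset X).
      left; rewrite eqEsubset VX andbT; apply/subsetP => x xX.
      rewrite !inE (subsetP XU) // andbT; apply: contra Xav => xpq.
      case/orP: xpq => /eqP xE; rewrite {x}xE in xX.
        apply: conS (_ : con (U :\ q)); last by rewrite pqP // !inE eqxx orbT.
        apply/subsetP => y /setD1P[yq yU]; have [->//|yp] := eqVneq y p.
        by apply: (subsetP VX); rewrite !inE negb_or yp yq.
      apply: conS (_ : con (U :\ p)); last by rewrite pqP // !inE eqxx.
      apply/subsetP => y /setD1P[yp yU]; have [->//|yq] := eqVneq y q.
      by apply: (subsetP VX); rewrite !inE negb_or yp yq.
    right; apply/imsetP; exists x => //; have /setDP[xU xpq] := xV.
    apply/eqP; rewrite eqEsubset subsetD1 XU xX; apply/subsetP => y /setD1P[yx yU].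
    apply/negPn/negP => yX; have := Xmax _ yU yX.
    apply/negP; apply: contra (_ : ~~ con (U :\ x)); last by rewrite pqP.
    apply: conS; rewrite subUset sub1set !inE yx yU /=.
    by rewrite subsetD1 XU xX.
  - split; [exact: subsetDl|by apply/negP => /con_card; rewrite cV ltnn|].
    move=> s sU; rewrite !inE sU andbT negbK => /orP[]/eqP->.
      apply: conS (_ : con (U :\ q)); last by rewrite pqP // !inE eqxx orbT.
      by apply/subsetP => y; rewrite !inE => /andP[yq ->]; rewrite (negPf yq); case: (y == p).
    apply: conS (_ : con (U :\ p)); last by rewrite pqP // !inE eqxx.
    by apply/subsetP => y; rewrite !inE => /andP[yq ->]; rewrite (negPf yq) /=; case: (y == q).
  - split; [exact: subsetDl|by rewrite pqP|].
    by move=> s sU; rewrite !inE sU andbT negbK => /eqP->; rewrite setD1K.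
rewrite cardsU1 card_in_imset ?cV; last first.
  move=> x y /setDP[xU _] _ /setP/(_ x).
  by rewrite !inE eqxx xU !andbT => /esym/negbFE/eqP.
suff -> : V \notin [set U :\ x | x in V] by [].
apply/imsetP => -[x /setDP[xU xpq] VE].
have := cardsD1 x U; rewrite xU cU -VE cV; lia.
Qed.

(** * Sets of at least [d + 3] points *)

Lemma card_simplices3 U : con U -> #|U| = d.+3 ->
  #|simplices U| = #|[set j in U | con (U :\ j)]|.
Proof.
move=> Ucon cU; set N := [set j in _ | _].
(* Pairs of a simplex and a point outside it are counted in two ways: a simplex omits 2 points, and
   each [j] in [N] is omitted by exactly the 2 simplices of [U :\ j]. *)
suff: \sum_(C in simplices U) 2 = \sum_(j in N) 2.
  by rewrite !sum_nat_const; lia.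
have cDC C : C \in simplices U -> 2 = \sum_(j in U :\: C) 1.
  by move=> /simplicesP[CU _ cC]; rewrite sum1_card cardsDS // cU cC; lia.
rewrite (eq_bigr _ cDC) (exchange_big_dep (mem N)) /=; last first.
  move=> C j /simplicesP[CU Ccon _] /setDP[jU jC]; rewrite inE jU.
  by apply: conS Ccon; rewrite subsetD1 CU.
apply: eq_bigr => j; rewrite inE => /andP[jU jcon].
rewrite -(@card_simplices2 (U :\ j)) //; last first.
  by move: (cardsD1 j U); rewrite jU cU => -[].
rewrite -sum1_card; apply: eq_bigl => C.
by rewrite !inE subsetD1 jU andbT -!andbA; do !bool_congr.
Qed.

Lemma card_avoiders_size U X : con U -> X \in avoiders U -> d <= #|X| < #|U|.
Proof.
move=> Ucon /avoidersP[XU Xav Xmax].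
have [t tU tX] : exists2 t, t \in U & t \notin X.
  by apply/subsetPn; apply: contra Xav => UX; apply: conS UX Ucon.
have := con_card (Xmax t tU tX); rewrite cardsU1 tX add1n ltnS => -> /=.
by apply: proper_card; apply/properP; split=> //; exists t.
Qed.

(* The complements of the simplices are the edges of a 2-regular graph on the
   [m] points whose deletion keeps [U] containing; the complements of maximal
   avoiding sets are the other points, the non-edges, and the triangles. *)
Lemma card_avoiders3 U : 0 < d -> con U -> #|U| = d.+3 ->
  #|avoiders U| + d <= d * #|simplices U|.
Proof.
move=> d_gt0 Ucon cU; have Ncard := card_simplices3 Ucon cU.
set N := [set j in _ | _] in Ncard; set S := simplices U in Ncard *.
have NU : N \subset U by apply/subsetP => j; rewrite inE => /andP[].
have setDK X : X \subset U -> U :\: (U :\: X) = X.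
  by move=> XU; rewrite setDDr setDv set0U; apply/setIidPr.
pose A k := [set X in avoiders U | #|X| == k].
(* The point missing from an avoiding set of size [d + 2] is not in [N], since its deletion leaves
   that avoiding set. *)
have A2le : #|A d.+2| <= d.+3 - #|N|.
  rewrite -cU -cardsDS // -(card_imset _ (@set1_inj T)).
  rewrite -(@card_in_imset _ _ (fun X => U :\: X) (mem (A d.+2))); last first.
    move=> X Y; rewrite !inE => /andP[/andP[XU _] _] /andP[/andP[YU _] _] XY.
    by rewrite -(setDK X) // XY setDK.
  apply: subset_leq_card; apply/subsetP => Y /imsetP[X]; rewrite inE.
  case/andP => /avoidersP[XU Xav _] /eqP cX ->.
  have /cards1P[x Ux] : #|U :\: X| == 1 by rewrite cardsDS // cU cX subSnn.
  rewrite Ux imset_f // !inE; have := setDK X XU; rewrite Ux => XE.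
  by rewrite XE (negPf Xav) andbF -sub1set -Ux subsetDl.
(* A two-point complement, of a maximal avoiding set or of a simplex, lies in [N]: restoring either
   point gives a containing set. The two families are disjoint because simplices are containing. *)
have A1le : #|A d.+1| + #|S| <= 'C(#|N|, 2).
  rewrite -cards_draws -(@cardsUI _ (A d.+1) S).
  have -> : A d.+1 :&: S = set0.
    apply/setP => X; rewrite !inE; case: (con X); rewrite /= ?andbF //.
  rewrite cards0 addn0.
  rewrite -(@card_in_imset _ _ (fun X => U :\: X)); last first.
    have AS_U X : X \in A d.+1 :|: S -> X \subset U.
      by rewrite !inE => /orP[/andP[/andP[]]|/andP[]].
    by move=> X Y /AS_U XU /AS_U YU XY; rewrite -(setDK X) // XY setDK.
  apply: subset_leq_card; apply/subsetP => Y /imsetP[X XAS ->].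
  rewrite inE; case/setUP: XAS => [|/simplicesP[XU Xcon cX]].
    rewrite inE => /andP[/avoidersP[XU Xav Xmax] /eqP cX].
    have -> : #|U :\: X| == 2 by rewrite cardsDS // cU cX; lia.
  rewrite andbT.
    apply/subsetP => j /setDP[jU jX]; rewrite inE jU /=.
    have /card_gt0P[k] : 0 < #|U :\: X :\ j|.
      have := cardsD1 j (U :\: X); rewrite cardsDS // !inE jX jU cU cX; lia.
    rewrite !inE => /and3P[kj kX kU]; apply: conS (Xmax k kU kX).
    by rewrite subUset sub1set !inE kj kU subsetD1 XU.
  have -> : #|U :\: X| == 2 by rewrite cardsDS // cU cX; lia.
  rewrite andbT.
  apply/subsetP => j /setDP[jU jX]; rewrite inE jU.
  by apply: conS Xcon; rewrite subsetD1 XU.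
(* Adding a point to an avoiding set of size [d] gives a simplex, in three ways. If two pairs give
   the same simplex, a point [j] outside it can replace both [t] and [u], so [t = u] by uniqueness
   of the exchange. *)
have A0le : #|A d| * 3 <= #|S|.
  rewrite -(@card_flags (A d) (fun X => U :\: X)); last first.
    move=> X; rewrite inE => /andP[/avoidersP[XU _ _] /eqP cX].
    by rewrite cardsDS // cU cX; lia.
  have flagP p : p \in [set p : {set T} * T | (p.1 \in A d) && (p.2 \in U :\: p.1)] ->
      [/\ p.1 \in avoiders U, p.2 \notin p.1 & p.2 |: p.1 \in S].
    case: p => X t; rewrite inE /= inE => /andP[/andP[XA /eqP cX] /setDP[tU tX]].
    have [XU Xav Xmax] := avoidersP _ _ XA; split=> //; apply/simplicesP.
    by rewrite subUset sub1set tU XU Xmax // cardsU1 tX cX.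
  rewrite -(@card_in_imset _ _ (fun p => p.2 |: p.1)).
    by apply: subset_leq_card; apply/subsetP => C /imsetP[p /flagP[_ _ ?] ->].
  move=> [X t] [Y u] /flagP[/= /avoidersP[_ _ Xmax] tX /simplicesP[CU Ccon cC]].
  move=> /flagP[/= /avoidersP[_ _ Ymax] uY _] CE.
  have [j jU jC] : exists2 j, j \in U & j \notin t |: X.
    by apply/subsetPn/negP => /subset_leq_card; rewrite cU cC; lia.
  have [c _ cP] := pivot Ccon cC jC.
  have tc : t = c.
    apply/eqP; rewrite -cP ?setU11 // setU1K //; apply: Xmax => //.
    by apply: contra jC => jX; rewrite inE jX orbT.
  have uc : u = c.
    apply/eqP; rewrite -cP CE ?setU11 // setU1K //; apply: Ymax => //.
    by apply: contra jC => jX; rewrite CE inE jX orbT.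
  by rewrite tc uc; congr (_, _); rewrite -(setU1K tX) CE tc -uc setU1K.
have AE : #|avoiders U| <= #|A d.+2| + #|A d.+1| + #|A d|.
  apply: leq_trans (_ : #|A d.+2 :|: A d.+1 :|: A d| <= _).
    apply: subset_leq_card; apply/subsetP => X XA.
    have XAE k : (X \in A k) = (#|X| == k) by rewrite in_set XA.
    by rewrite !in_setU !XAE; have := card_avoiders_size Ucon XA; rewrite cU; lia.
  by rewrite -addnA; apply: leq_trans (leq_card_setU _ _) _; rewrite addnA leq_add2r leq_card_setU.
have N_le : #|N| <= d.+3 by rewrite -cU subset_leq_card.
have S_gt0 : 0 < #|S| by apply/card_gt0P; apply: con_simplex.
have bN := bin2 #|N|.
rewrite Ncard in A1le A0le S_gt0 *.
move: #|N| #|A d.+2| #|A d.+1| #|A d| #|avoiders U| A2le A1le A0le AE N_le S_gt0 {Ncard} bN.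
move=> m a2 a1 a0 a A2le A1le A0le AE N_le m_gt0 bN.
(* This bound excludes [m] equal to 1 or 2; at [m = 3] the final inequality uses [0 < d]. *)
have {A1le bN} : (a1 + m) * 2 <= m * m.-1 by lia.
have [e dE] : exists e, d + 3 = m + e by exists (d + 3 - m); lia.
case: m A2le A0le AE N_le m_gt0 dE => [|[|[|[|[|m]]]]]; try lia.
by move=> *; nia.
Qed.

(** The point deleted in the induction is taken outside a simplex, so that the smaller set stays
    containing. *)
Lemma card_avoiders_ge3 U : 0 < d -> con U -> d.+3 <= #|U| ->
  #|avoiders U| + d <= d * #|simplices U|.
Proof.
move=> d_gt0; elim: {U}#|U| {-2}U (erefl #|U|) => [|n IHn] U cU Ucon; rewrite cU //.
rewrite leq_eqVlt => /predU1P[nE|n_gt].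
  by apply: card_avoiders3; rewrite // cU -nE.
have [C /simplicesP[CU Ccon cC]] := con_simplex Ucon.
have [i iU iC] : exists2 i, i \in U & i \notin C.
  by apply/subsetPn/negP => /subset_leq_card; rewrite cU cC; lia.
have cUi : #|U :\ i| = n by move: (cardsD1 i U); rewrite iU cU => -[].
have := card_avoidersD1 iU; have := IHn _ cUi; rewrite cUi.
have -> : con (U :\ i) by apply: conS Ccon; rewrite subsetD1 CU.
lia.
Qed.

End Counting.

(** * Simplicial cones *)

From mathcomp Require Import boolp.
Import Order.TTheory GRing.Theory Num.Theory.
Local Open Scope ring_scope.

Section Cone.
Variables (R : realFieldType) (E : vectType R) (T : finType).
Variables (w : T -> E) (wz : E) (d : nat).
Implicit Types (X Y C D U : {set T}) (m : T -> R).

(** Coefficients are functions on all of [T], so that combinations over different sets can be added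
    and compared. *)
Definition supported C m := forall x, x \notin C -> m x = 0.

Definition lincomb m := \sum_x m x *: w x.

Definition in_cone X :=
  `[< exists m, [/\ supported X m, forall x, 0 <= m x & lincomb m = wz] >].

(* When [C] is a basis, the coordinate [m t] is a linear form vanishing on
   [C :\ t]: this is the closed half-space opposite to [t]. *)
Definition opposite_side C t :=
  [set s | `[< exists m, [/\ supported C m, lincomb m = w s & m t <= 0] >]].

Local Notation simplices := (simplices d in_cone).
Local Notation avoiders := (avoiders in_cone).

Lemma lincombD m n : lincomb (fun x => m x + n x) = lincomb m + lincomb n.
Proof. by rewrite -big_split /=; apply: eq_bigr => x _; rewrite scalerDl. Qed.

Lemma lincombZ a m : lincomb (fun x => a * m x) = a *: lincomb m.
Proof. by rewrite scaler_sumr; apply: eq_bigr => x _; rewrite scalerA. Qed.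

Lemma lincombB m n : lincomb (fun x => m x - n x) = lincomb m - lincomb n.
Proof. by rewrite -sumrB; apply: eq_bigr => x _; rewrite scalerBl. Qed.

Lemma lincomb1 s : lincomb (fun x => (x == s)%:R) = w s.
Proof.
rewrite /lincomb (bigD1 s) //= eqxx scale1r big1 ?addr0 // => x /negPf->.
by rewrite scale0r.
Qed.

Lemma lincomb_sum (I : finType) (a : I -> R) (f : I -> T -> R) :
  lincomb (fun y => \sum_i a i * f i y) = \sum_i a i *: lincomb (f i).
Proof.
rewrite /lincomb; under eq_bigr do rewrite scaler_suml.
rewrite exchange_big; apply: eq_bigr => i _; rewrite scaler_sumr.
by apply: eq_bigr => y _; rewrite scalerA.
Qed.

Lemma in_coneS X Y : X \subset Y -> in_cone X -> in_cone Y.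
Proof.
move=> XY /asboolP[m [mX m0 mz]]; apply/asboolP; exists m; split=> // x.
by move=> xY; apply: mX; apply: contra xY; apply: (subsetP XY).
Qed.

(** The ratio test of the simplex method: [e] is the least [l x / m x] over the positive [m x],
    attained at [c0]. Where [m x] is not positive, subtracting [e * m x] cannot lower [l x]. *)
Lemma first_vanishing (l m : T -> R) c : (forall x, 0 <= l x) -> 0 < m c ->
  exists e c0, [/\ 0 < m c0, l c0 = e * m c0 & forall x, 0 <= l x - e * m x].
Proof.
move=> l0 mc.
case: (@Order.TotalTheory.arg_minP _ _ _ c (fun x => 0 < m x) (fun x => l x / m x) mc).
move=> c0 mc0 c0min; exists (l c0 / m c0), c0; split=> [//||x].
  by rewrite divfK // gt_eqF.
rewrite subr_ge0; have [mx|mx] := ltP 0 (m x).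
  by rewrite -ler_pdivlMr //; apply: c0min.
by apply: le_trans (l0 x); rewrite mulr_ge0_le0 // divr_ge0 // ltW.
Qed.

Definition independent C := forall m, supported C m -> lincomb m = 0 -> forall x, m x = 0.

Definition spanning C := forall v, exists2 m, supported C m & lincomb m = v.

Lemma independent_inj C m n : independent C -> supported C m -> supported C n ->
  lincomb m = lincomb n -> forall x, m x = n x.
Proof.
move=> Cind mC nC mn x; apply/eqP; rewrite -subr_eq0; apply/eqP.
apply: (Cind (fun y => m y - n y)) => [y yC|]; first by rewrite mC // nC // subrr.
by rewrite lincombB mn subrr.
Qed.

Lemma card_basis C : independent C -> spanning C -> #|C| = \dim {:E}.
Proof.
move=> Cind Cspan; pose X := [tuple w (enum_val i) | i < #|C|].
have XE (i : 'I_#|C|) : X`_i = w (enum_val i) by rewrite -tnth_nth tnth_mktuple.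
have Xfree : free X.
  apply/freeP => k k0 i; pose m x := \sum_(j | enum_val j == x :> T) k j.
  have mE : m (enum_val i) = k i.
    rewrite /m (bigD1 i) //= big1 ?addr0 // => j /andP[/eqP/enum_val_inj->].
    by rewrite eqxx.
  rewrite -mE; apply: Cind.
    move=> x xC; rewrite /m big1 // => j /eqP xE; case/negP: xC.
    by rewrite -xE enum_valP.
  rewrite -[RHS]k0 [RHS](partition_big (fun j : 'I_#|C| => enum_val j) xpredT) //=.
  apply: eq_bigr => x _; rewrite scaler_suml; apply: eq_bigr => j /eqP <-.
  by rewrite XE.
have Xspan : <<X>>%VS = {:E}%VS.
  apply/eqP; rewrite eqEsubv subvf; apply/subvP => v _.
  have [m mC <-] := Cspan v; apply: memv_suml => x _.
  have [xC|/mC->] := boolP (x \in C); last by rewrite scale0r mem0v.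
  apply/memvZ/memv_span/tnthP; exists (enum_rank_in xC x).
  by rewrite tnth_mktuple enum_rankK_in.
by rewrite -Xspan (eqP Xfree) size_tuple.
Qed.

(** [general] is the linear form of general position; [pointed] holds for lifted points because they
    all have height 1. *)
Hypothesis dimE : \dim {:E} = d.+1.
Hypothesis general : forall C m, supported C m -> lincomb m = wz -> spanning C.
Hypothesis pointed : forall m x, lincomb m = w x -> exists y, 0 < m y.

(** Carathéodory's argument: a linear relation would allow the weights to be moved until one
    vanishes, against minimality. So [C] is independent; it spans by [general], hence has [d + 1]
    points. *)
Lemma minset_cone C : minset in_cone C ->
  [/\ exists l, [/\ supported C l, forall x, x \in C -> 0 < l x & lincomb l = wz],
      independent C, spanning C & #|C| = d.+1].
Proof.
move=> /minsetP[/asboolP[l [lC l0 lz]] Cmin].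
have dropC n c : c \in C -> (forall x, 0 <= n x) -> supported C n -> n c = 0 ->
    lincomb n = wz -> False.
  move=> cC n0 nC nc nz; have: C :\ c = C.
    apply: Cmin; last exact: subsetDl.
    apply/asboolP; exists n; split=> // x.
    by rewrite !inE negb_and negbK => /predU1P[->|/nC].
  by move=> /setP/(_ c); rewrite !inE eqxx cC.
have Cind : independent C.
  move=> m.
  wlog suff main : m / supported C m -> lincomb m = 0 -> forall x, ~ 0 < m x.
    move=> mC mz x; apply/eqP; rewrite eq_le !leNgt; apply/andP; split; apply/negP.
      exact: main.
    move=> mx; apply: (main (fun x => -1 * m x)) (x) _.
    - by move=> y yC; rewrite mC // mulr0.
    - by rewrite lincombZ mz scaler0.
    - by rewrite mulN1r oppr_gt0.
  move=> mC mz x mx; have [e [c [mc lc e0]]] := first_vanishing l0 mx.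
  have cC : c \in C by apply: contraTT mc => /mC->; rewrite ltxx.
  apply: (dropC (fun x => l x - e * m x) c) => //.
  - by move=> y yC; rewrite lC // mC // mulr0 subrr.
  - by rewrite lc subrr.
  - by rewrite lincombB lincombZ mz scaler0 subr0.
have Cspan := general lC lz.
split=> //; last by rewrite card_basis.
exists l; split=> // x xC; rewrite lt_def l0 andbT; apply/eqP => lx.
exact: (dropC l x).
Qed.

(** * Simplices and the exchange of a point *)

Lemma in_cone_simplex U : in_cone U -> exists C, C \in simplices U.
Proof.
move=> /minset_exists[C Cmin CU]; exists C; apply/simplicesP.
by have [_ _ _ ?] := minset_cone Cmin; split=> //; apply: minsetp Cmin.
Qed.

Lemma simplex_basis C : in_cone C -> #|C| = d.+1 ->
  [/\ exists l, [/\ supported C l, forall x, x \in C -> 0 < l x & lincomb l = wz],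
      independent C & spanning C].
Proof.
move=> /minset_exists[D Dmin DC] cC; have [l Dind Dspan cD] := minset_cone Dmin.
by have <- : D = C by apply/eqP; rewrite eqEcard DC cC cD leqnn.
Qed.

(** A pivot step: the weight of [s] is raised along the relation [w s = lincomb m] until a first
    coordinate [c] vanishes. The step [e] is positive because all weights on [C] are. *)
Lemma cone_exchange C l m s : (forall x, 0 <= l x) -> supported C l -> lincomb l = wz ->
    (forall x, x \in C -> 0 < l x) ->
    s \notin C -> supported C m -> lincomb m = w s -> (exists x, 0 < m x) ->
  exists e c, let n x := l x - e * m x + e * (x == s)%:R in
    [/\ 0 < e, c \in C, supported (s |: C :\ c) n, forall x, 0 <= n x & lincomb n = wz].
Proof.
move=> l0 lC lz lpos sC mC ms [x mx].
have [e [c [mc lc e0]]] := first_vanishing l0 mx.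
have cC : c \in C by apply: contraTT mc => /mC->; rewrite ltxx.
have e_gt0 : 0 < e by rewrite -(pmulr_lgt0 _ mc) -lc lpos.
exists e, c; split=> //.
- move=> y; rewrite !inE !negb_or negb_and negbK => /andP[/negPf-> yC].
  rewrite mulr0 addr0; case/predU1P: yC => [->|yC]; first by rewrite lc subrr.
  by rewrite lC // mC // mulr0 subrr.
- by move=> y; rewrite addr_ge0 // mulr_ge0 ?ler0n // ltW.
- by rewrite lincombD lincombB !lincombZ lincomb1 ms lz subrK.
Qed.

Lemma supported_ge0 C l : supported C l -> (forall x, x \in C -> 0 < l x) ->
  forall x, 0 <= l x.
Proof. by move=> lC l0 x; have [/l0/ltW|/lC->] := boolP (x \in C). Qed.

Lemma card_exchange C s c : s \notin C -> c \in C -> #|s |: C :\ c| = #|C|.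
Proof.
move=> sC cC; rewrite cardsU1 !inE (negPf sC) andbF /= (cardsD1 c C) cC; lia.
Qed.

(** Existence is the pivot step. For uniqueness, a solution omitting another [c'] would have the
    same weight at [s], hence vanish at both [c] and [c'], leaving a containing set of only [d]
    points. *)
Lemma in_cone_pivot C s : in_cone C -> #|C| = d.+1 -> s \notin C ->
  exists2 c, c \in C & forall c', c' \in C -> in_cone (s |: C :\ c') = (c' == c).
Proof.
move=> Ccone cC sC; have [[l [lC lpos lz]] Cind Cspan] := simplex_basis Ccone cC.
have l0 := supported_ge0 lC lpos.
have [m mC ms] := Cspan (w s).
have [e [c [e0 cC' nC n0 nz]]] := cone_exchange l0 lC lz lpos sC mC ms (pointed ms).
exists c => // c' c'C; apply/idP/eqP => [/asboolP[k [kC k0 kz]]|->]; last first.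
  by apply/asboolP; eexists; split; [exact: nC|exact: n0|exact: nz].
(* Any solution supported on [s |: C] differs from [l] by a multiple of the
   dependency [w s = lincomb m]. *)
have kE x : k x + k s * m x - k s * (x == s)%:R = l x.
  apply: (independent_inj Cind
    (m := fun x => k x + k s * m x - k s * (x == s)%:R)) => // [y yC|].
    rewrite mC // mulr0 addr0; have [->|ys] := eqVneq y s; first by rewrite mulr1 subrr.
    by rewrite kC ?mulr0 ?subrr // !inE negb_or ys (negPf yC) andbF.
  by rewrite lincombB lincombD !lincombZ lincomb1 ms kz addrK.
apply/eqP; apply: contraT => c'c.
have scE y : y \in C -> (y == s) = false by move=> yC; apply: contraNF sC => /eqP <-.
have nc : l c = e * m c.
  have /= := nC c; rewrite !inE scE // eqxx mulr0 addr0 => /(_ isT)/eqP.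
  by rewrite subr_eq0 => /eqP.
have kc' : l c' = k s * m c'.
  have := kE c'; rewrite scE // mulr0 subr0 => <-; rewrite kC ?add0r //.
  by rewrite !inE negb_or scE ?eqxx.
have := kE c; rewrite scE // mulr0 subr0 => kc.
have := n0 c'; rewrite scE // mulr0 addr0 => nc'.
(* Each solution is nonnegative at the coordinate where the other vanishes, which gives the two
   inequalities. *)
have es : e = k s.
  have mc : 0 < m c by rewrite -(pmulr_rgt0 _ e0) -nc lpos.
  have ks0 : 0 < k s.
    rewrite lt_def k0 andbT; apply: contraTneq (lpos _ c'C) => ks.
    by rewrite kc' ks mul0r ltxx.
  have mc' : 0 < m c' by rewrite -(pmulr_rgt0 _ ks0) -kc' lpos.
  apply/eqP; rewrite eq_le; apply/andP; split.
    by rewrite -(ler_pM2r mc') -kc' -subr_ge0.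
  by rewrite -(ler_pM2r mc) -nc -kc lerDr k0.
have: in_cone (s |: C :\ c :\ c').
  apply/asboolP; exists k; split=> // x xC.
  have [xc|xc] := eqVneq x c; last first.
    by apply: kC; apply: contra xC; rewrite !inE xc.
  by move: kc; rewrite xc nc es -[RHS]add0r => /addIr.
move=> /(con_card in_cone_simplex); rewrite cardsU1 !inE (negPf sC) !andbF /=.
have := cardsD1 c C; have := cardsD1 c' (C :\ c).
by rewrite !inE c'c c'C cC' cC; lia.
Qed.

Lemma avoiders_opposite_sideP U X t : X \in avoiders U -> t \in U :\: X ->
  exists C, [/\ t \in C, C \in simplices (t |: X) & X = U :&: opposite_side C t].
Proof.
move=> /avoidersP[XU Xav Xmax] /setDP[tU tX].
pose F := simplices (t |: X).
have [lam lamP] : {lam : {set T} -> T -> R & forall C, C \in F ->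
    [/\ supported C (lam C), forall x, x \in C -> 0 < lam C x & lincomb (lam C) = wz]}.
  apply: (choice (P := fun C l => C \in F -> [/\ supported C l,
    forall x, x \in C -> 0 < l x & lincomb l = wz])) => C.
  have [CF|_] := boolP (C \in F); last by exists (fun _ => 0).
  have /simplicesP[_ Ccone cC] := CF.
  by have [[l lP] _ _] := simplex_basis Ccone cC; exists l.
have [C0 C0F] := in_cone_simplex (Xmax _ tU tX).
case: (@Order.TotalTheory.arg_minP _ _ _ C0 (mem F) (fun C => lam C t) C0F) => C CF Cmin.
have /simplicesP[CX Ccone cC] := CF; have [lC lpos lz] := lamP C CF.
have [_ Cind Cspan] := simplex_basis Ccone cC.
have tC : t \in C.
  apply: contraNT Xav => tC; apply: in_coneS Ccone; apply/subsetP => x xC.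
  by have := subsetP CX x xC; rewrite !inE => /predU1P[xt|//]; rewrite -xt xC in tC.
have Xside s : s \in X -> s \in opposite_side C t.
  move=> sX; rewrite inE; have [m mC ms] := Cspan (w s).
  apply/asboolP; exists m; split=> //; rewrite leNgt; apply/negP => mt.
  have ts : (t == s) = false by apply: contraNF tX => /eqP->.
  have sC : s \notin C.
    apply/negP => sC; move: mt.
    rewrite (independent_inj Cind mC _ (etrans ms (esym (lincomb1 s)))).
      by rewrite ts ltxx.
    by move=> x xC; case: eqP xC => // ->; rewrite sC.
  have [e [c [e0 cC' nC n0 nz]]] :=
    cone_exchange (supported_ge0 lC lpos) lC lz lpos sC mC ms (ex_intro _ t mt).
  set n := (fun x : T => _) in nC n0 nz.
  have DF : s |: C :\ c \in F.
    apply/simplicesP; split; last by rewrite card_exchange.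
      apply/subsetP => x; rewrite in_setU1 => /predU1P[->|/setD1P[_ /(subsetP CX)//]].
      by rewrite inE sX orbT.
    by apply/asboolP; exists n.
  have /simplicesP[_ Dcone cD] := DF; have [lD _ lDz] := lamP _ DF.
  have [_ Dind _] := simplex_basis Dcone cD.
  (* The exchange lowers the weight of [t] by [e * m t], against the choice of [C]. *)
  have := Cmin _ DF; rewrite (independent_inj Dind lD nC (etrans lDz (esym nz))).
  by rewrite /n ts mulr0 addr0 lerBrDr gerDl leNgt mulr_gt0.
exists C; split=> //; apply/eqP; rewrite eqEsubset; apply/andP; split.
  by apply/subsetP => s sX; rewrite inE (subsetP XU) // Xside.
apply/subsetP => s /setIP[sU sside]; apply/negPn/negP => sX.
(* Otherwise [wz] is a nonnegative combination of vectors with nonpositive [t]-coordinate, while its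
   own [t]-coordinate is positive. *)
have /asboolP[n [nX n0 nz]] := Xmax _ sU sX.
have [f fP] : {f : T -> T -> R & forall x, x \in s |: X ->
    [/\ supported C (f x), lincomb (f x) = w x & f x t <= 0]}.
  apply: (choice (P := fun x f => x \in s |: X ->
    [/\ supported C f, lincomb f = w x & f t <= 0])) => x.
  have [xX|_] := boolP (x \in s |: X); last by exists (fun _ => 0).
  suff: x \in opposite_side C t by rewrite inE => /asboolP[m mP]; exists m.
  by move: xX; rewrite in_setU1 => /predU1P[->//|/Xside].
have := lpos t tC; apply/negP; rewrite -leNgt.
rewrite (independent_inj Cind lC (n := fun y => \sum_x n x * f x y)).
- apply: sumr_le0 => x _; have [/fP[_ _ ft]|/nX->] := boolP (x \in s |: X).
    exact: mulr_ge0_le0.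
  by rewrite mul0r.
- move=> y yC; apply: big1 => x _; have [/fP[fC _ _]|/nX->] := boolP (x \in s |: X).
    by rewrite fC ?mulr0.
  by rewrite mul0r.
- rewrite lz lincomb_sum -nz; apply: eq_bigr => x _.
  by have [/fP[_ -> _]|/nX->] := boolP (x \in s |: X); rewrite ?scale0r.
Qed.

End Cone.

(** * Convex and affine hulls *)

From mathcomp Require Import finmap.
From mathcomp Require Import all_classical all_reals all_analysis.
Import Order.TTheory GRing.Theory Num.Theory.
Import numFieldNormedType.Exports.

Section AffineHull.
Variables (R : realType) (d : nat).
Implicit Types (p q : 'rV[R]_d) (V W : {vspace 'rV[R]_d}).

Lemma translateP p V x : translate p V x <-> x - p \in V.
Proof.
split=> [[v vV <-]|xV]; first by rewrite addrC addKr.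
by exists (x - p); rewrite //= addrC subrK.
Qed.

(** Uniqueness of the direction, which makes the choice in [direction] return the expected space. *)
Lemma translate_inj p q V W : translate p V = translate q W -> V = W.
Proof.
move=> pqE; have pqP x : (x - p \in V) = (x - q \in W).
  by apply/idP/idP => /translateP; [rewrite pqE|rewrite -pqE] => /translateP.
have pqW : p - q \in W by rewrite -pqP subrr mem0v.
apply/vspaceP => v; have := pqP (v + p); rewrite addrK => ->.
by rewrite -addrA rpredDr.
Qed.

Lemma affine_dim_translate p V : affine_dim (translate p V) = (\dim V)%:Z.
Proof.
have pV : translate p V p by apply/translateP; rewrite subrr mem0v.
rewrite /affine_dim; case: asboolP => [E|_]; first by rewrite E in pV.
have := @xgetPex _ 0%VS [set W | exists q, translate p V = translate q W]%classic.
by rewrite -/(direction _) => -[|q /translate_inj<-//]; exists V, p.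
Qed.

Lemma affine_hull_translate (I : finType) (C : {set I}) (f : I -> 'rV[R]_d) i :
  i \in C ->
  affine_hull [set f j | j in [set` C]]%classic =
  translate (f i) (\sum_(j in C) <[f j - f i]>)%VS.
Proof.
move=> iC; set V := (\sum_(j in C) _)%VS; apply/seteqP; split.
  apply: smallest_sub; first by right; exists (f i), V.
  move=> _ [j /= jC <-]; apply/translateP; apply: subvP (memv_line _).
  exact: (sumv_sup j).
move=> x /translateP xV A [Aaff CA].
have CA' j : j \in C -> A (f j) by move=> jC; apply: CA; exists j.
case: Aaff => [A0|[q [W AE]]]; first by have := CA' _ iC; rewrite A0.
have CW j : j \in C -> f j - q \in W by move=> /CA'; rewrite AE => /translateP.
rewrite AE; apply/translateP; rewrite -(subrK (f i) x) -addrA rpredDr ?CW //.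
apply: subvP xV; apply/subv_sumP => j jC; rewrite -memvE.
have -> : f j - f i = (f j - q) - (f i - q) by rewrite opprB addrA subrK.
by rewrite rpredB ?CW.
Qed.

End AffineHull.

Lemma continuous_affine_form (R : realType) d (z : 'rV[R]_d) (l : R) (n : 'I_d -> R) :
  continuous (fun y : 'rV[R]_d => l + \sum_j (y 0 j - z 0 j) * n j).
Proof.
move=> y; apply: continuousD; first exact: cst_continuous.
apply: (@continuous_big R _ +%R 0) y => [|j _ y]; first exact: add_continuous.
apply: (@continuousM R _ (fun y : 'rV[R]_d => y 0 j - z 0 j) (fun _ => n j)).
  apply: (@continuousB R R^o _ (fun y : 'rV[R]_d => y 0 j) (fun _ => z 0 j)).
    exact: coord_continuous.
  exact: cst_continuous.
exact: cst_continuous.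
Qed.

(** * Lifting to height 1: convex hulls as cones *)

Section Homogenize.
Variables (R : realType) (d : nat) (T : finType) (f : T -> 'rV[R]_d).
Implicit Types (C X : {set T}) (m : T -> R).

(* Points of [R^d] are lifted to height 1, so that affine combinations become
   linear ones. *)
Definition homogenize (p : 'rV[R]_d) : R^o * 'rV[R]_d := (1, p).

Local Notation w := (fun x => homogenize (f x)).

Lemma lincomb_homogenize m : lincomb w m = (\sum_x m x, \sum_x m x *: f x).
Proof.
apply: injective_projections; rewrite /lincomb /=.
  by rewrite (raddf_sum fst) /=; apply: eq_bigr => x _; rewrite /= /GRing.scale /= mulr1.
by rewrite (raddf_sum snd).
Qed.

Lemma in_cone_homogenizeP X y :
  reflect (exists m, [/\ supported X m, forall x, 0 <= m x, \sum_x m x = 1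
                       & \sum_x m x *: f x = y])
          (in_cone w (homogenize y) X).
Proof.
apply: (iffP idP) => [/asboolP[m [mX m0]]|[m [mX m0 m1 my]]].
  by rewrite lincomb_homogenize => -[m1 my]; exists m.
by apply/asboolP; exists m; split; rewrite // lincomb_homogenize m1 my.
Qed.

(** Induction on [#|X|]: a point is split off and the other weights are divided by their sum
    [1 - m x]. The case [m x = 1], where no weight remains, is separate. *)
Lemma convex_comb (M : set 'rV[R]_d) X m : @convex_set R 'rV[R]_d M ->
  (forall x, x \in X -> M (f x)) -> supported X m -> (forall x, 0 <= m x) ->
  \sum_x m x = 1 -> M (\sum_x m x *: f x).
Proof.
move=> Mconv; elim: {X}#|X| {-2}X (erefl #|X|) m => [|n IHn] X cX m XM mX m0 m1.
  move: m1; rewrite big1 => [/esym/eqP|x _]; first by rewrite oner_eq0.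
  by apply: mX; rewrite (cards0_eq cX) inE.
have /card_gt0P[x xX] : (0 < #|X|)%N by rewrite cX.
have mD : \sum_(y | y != x) m y = 1 - m x.
  by apply/eqP; rewrite eq_sym subr_eq -m1 (bigD1 x) //= addrC.
have mx1 : m x <= 1 by rewrite -subr_ge0 -mD sumr_ge0.
have [mxE|mx_neq1] := eqVneq (m x) 1.
  rewrite (bigD1 x) //= mxE scale1r big1 ?addr0; first exact: XM.
  move=> y yx; move/eqP: mD; rewrite mxE subrr psumr_eq0 // => /allP/(_ y).
  by rewrite mem_index_enum yx => /(_ isT)/eqP->; rewrite scale0r.
have mx_gt0 : 0 < 1 - m x by rewrite subr_gt0 lt_neqAle mx_neq1.
pose k y := if y == x then 0 else m y / (1 - m x).
have kM : M (\sum_y k y *: f y).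
  apply: (IHn (X :\ x)).
  - by move: (cardsD1 x X); rewrite xX cX => -[].
  - by move=> y /setD1P[_ /XM].
  - move=> y; rewrite !inE negb_and negbK /k; case: eqP => //= _ /mX->.
    by rewrite mul0r.
  - by move=> y; rewrite /k; case: eqP => // _; rewrite divr_ge0 // ltW.
  - rewrite (bigD1 x) //= /k eqxx add0r.
    under eq_bigr => y /negPf-> do [].
    by rewrite -mulr_suml mD divff // gt_eqF.
have := Mconv (f x) (\sum_y k y *: f y) (Itv01 (m0 x) mx1).
rewrite !in_setE => /(_ (XM x xX) kM); congr M.
rewrite [RHS](bigD1 x) //=; congr (_ + _).
rewrite scaler_sumr (bigD1 x) //= /k eqxx scale0r scaler0 add0r.
apply: eq_bigr => y /negPf->; rewrite scalerA mulrC divfK //.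
by rewrite gt_eqF.
Qed.

Lemma conv_hull_cone X y :
  conv_hull [set f x | x in [set` X]]%classic y <-> in_cone w (homogenize y) X.
Proof.
split; last first.
  move=> /in_cone_homogenizeP[m [mX m0 m1 <-]] M [Mconv XM].
  by apply: convex_comb mX m0 m1 => // x xX; apply: XM; exists x.
move: y; apply: smallest_sub => [y1 y2 a|_ [x /= xX <-]].
  move=> /set_mem/in_cone_homogenizeP[m [mX m0 m1 <-]] /set_mem/in_cone_homogenizeP[n [nX n0 n1 <-]].
  have a0 : 0 <= a%:num by []. have a1 : 0 <= 1 - a%:num by rewrite subr_ge0.
  apply/mem_set/in_cone_homogenizeP; exists (fun x => a%:num * m x + (1 - a%:num) * n x); split.
  - by move=> x xX; rewrite mX // nX // !mulr0 addr0.
  - by move=> x; rewrite addr_ge0 // mulr_ge0.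
  - by rewrite big_split /= -!mulr_sumr m1 n1 !mulr1 addrC subrK.
  - under eq_bigr do rewrite scalerDl -!scalerA.
    by rewrite big_split /= -!scaler_sumr.
apply/in_cone_homogenizeP; exists (fun y => (y == x)%:R); split.
- by move=> y yX; case: eqP yX => // ->; rewrite xX.
- by move=> y; rewrite ler0n.
- by rewrite (bigD1 x) //= eqxx big1 ?addr0 // => y /negPf->.
- rewrite (bigD1 x) //= eqxx scale1r big1 ?addr0 // => y /negPf->.
  by rewrite scale0r.
Qed.

Lemma dim_homogenize : \dim {: (R^o * 'rV[R]_d)%type} = d.+1.
Proof. by rewrite dimvf /dim /= dim_matrix mul1r. Qed.

(** The relation puts [z] in the affine hull of [C], which must then have full dimension. So the
    differences [f j - f i] span [R^d], and with the lift of [f i] they give the whole lifted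
    space. *)
Lemma spanning_homogenize C z m : supported C m -> lincomb w m = homogenize z ->
  ~ (affine_dim (affine_hull [set f x | x in [set` C]]%classic) < d%:Z /\
     affine_hull [set f x | x in [set` C]]%classic z) ->
  spanning w C.
Proof.
move=> mC; rewrite lincomb_homogenize => -[m1 mz] zgen.
have [i iC] : exists i, i \in C.
  apply/set0Pn; apply: contra_eqN m1 => /eqP C0.
  by rewrite big1 ?(eq_sym 0) ?oner_eq0 // => x _; apply: mC; rewrite C0 inE.
rewrite (affine_hull_translate _ iC) affine_dim_translate in zgen.
set V := (\sum_(j in C) _)%VS in zgen.
have VE : V = fullv.
  apply/eqP; rewrite eqEdim subvf dimvf dim_matrix mul1r leqNgt; apply/negP => Vd.
  apply: zgen; split; first by rewrite ltz_nat.
  apply/translateP; rewrite -[f i]scale1r -mz -m1 scaler_suml -sumrB.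
  apply: memv_suml => j _; rewrite -scalerBr.
  have [jC|/mC->] := boolP (j \in C); last by rewrite scale0r mem0v.
  by apply/memvZ/(subvP _ _ (memv_line _)); apply: (sumv_sup j).
move=> [a b]; have: b - a *: f i \in V by rewrite VE memvf.
move=> /memv_sumP[vs vsP bE].
have [k kP] : {k : T -> R & forall j, j \in C -> vs j = k j *: (f j - f i)}.
  apply: (choice (P := fun j c => j \in C -> vs j = c *: (f j - f i))) => j.
  have [/vsP/vlineP[c ->]|_] := boolP (j \in C); last by exists 0.
  by exists c.
pose k' j := if j \in C then k j else 0.
have kE : b - a *: f i = \sum_j k' j *: (f j - f i).
  rewrite bE big_mkcond; apply: eq_bigr => j _; rewrite /k'.
  by case: ifP => [/kP//|_]; rewrite scale0r.
(* The correction at [i] makes the coefficients sum to the height [a]. *)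
exists (fun j => k' j + (a - \sum_x k' x) * (j == i)%:R).
  move=> j jC; rewrite /k' (negPf jC) add0r; case: eqP jC => [->|]; rewrite ?iC ?mulr0 //.
rewrite lincombD lincombZ lincomb1 lincomb_homogenize; apply: injective_projections => /=.
  by rewrite /GRing.scale /= mulr1 addrC subrK.
have -> : \sum_x k' x *: f x = b - a *: f i + (\sum_x k' x) *: f i.
  by rewrite kE scaler_suml -big_split /=; apply: eq_bigr => j _; rewrite -scalerDr subrK.
by rewrite scalerBl addrACA subrK subrr addr0.
Qed.

(** The weights of [z] on a simplex [C] are positive. Those of a nearby [y] are the [k y], obtained
    by expressing the horizontal directions in the basis [C]; they depend continuously on [y] and so
    stay positive. *)
Lemma interior_cone X z :
  (forall C m, supported C m -> lincomb w m = homogenize z -> spanning w C) ->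
  interior (conv_hull [set f x | x in [set` X]]%classic) z <-> in_cone w (homogenize z) X.
Proof.
move=> zgen; split=> [/interior_subset/conv_hull_cone//|Xcone].
have [C /simplicesP[CX Ccone cC]] := in_cone_simplex dim_homogenize zgen Xcone.
have [[l [lC lpos lz]] _ Cspan] := simplex_basis dim_homogenize zgen Ccone cC.
have [n nP] : {n : 'I_d -> T -> R & forall j,
    supported C (n j) /\ lincomb w (n j) = (0, delta_mx 0 j)}.
  apply: (choice (P := fun j m => supported C m /\ lincomb w m = (0, delta_mx 0 j))) => j.
  by have [m mC mE] := Cspan (0, delta_mx 0 j); exists m.
pose k (y : 'rV[R]_d) x := l x + \sum_j (y 0 j - z 0 j) * n j x.
have kpos : \forall y \near z, forall x, x \in C -> 0 < k y x.
  apply: (@filter_forall _ T (fun x y => x \in C -> 0 < k y x) (nbhs z) _) => x.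
  have [xC|_] := boolP (x \in C); last exact: nearW.
  suff: (k y x @[y --> z] --> k z x)%classic.
    move=> /cvgr_gt/(_ 0); rewrite /k big1 ?addr0 => [/(_ (lpos x xC))|].
      by apply: filterS.
    by move=> j _; rewrite subrr mul0r.
  exact: continuous_affine_form.
apply: filterS kpos => y ypos; apply/conv_hull_cone; apply: in_coneS CX _.
have kC : supported C (k y).
  move=> x xC; rewrite /k lC // add0r big1 // => j _.
  by rewrite (nP j).1 // mulr0.
apply/asboolP; exists (k y); split=> //; first exact: supported_ge0 kC ypos.
rewrite /k lincombD lz lincomb_sum.
under eq_bigr do rewrite (nP _).2.
apply: injective_projections => /=.
  rewrite (raddf_sum fst) /= big1 ?addr0 // => j _; exact: mulr0.
rewrite (raddf_sum snd) /=.
rewrite -[RHS](subrK z) [RHS]addrC [y - z]row_sum_delta; congr (_ + _).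
by apply: eq_bigr => j _; rewrite !mxE.
Qed.

End Homogenize.

(** * From finite sets of points to subsets of a finite type *)

Section Transfer.
Variables (R : realType) (d : nat) (S : {fset 'rV[R]_d}) (z : 'rV[R]_d).
Hypothesis zS : general_position z S.

Local Notation w := (fun x : S => homogenize (val x)).
Local Notation cone := (in_cone w (homogenize z)).

Definition fset_of (C : {set S}) : {fset 'rV[R]_d} := [fset val x | x in C]%fset.

Lemma mem_fset_of C x : (val x \in fset_of C) = (x \in C).
Proof. by rewrite /fset_of mem_imfset //; apply: val_inj. Qed.

Lemma fset_of_inj : injective fset_of.
Proof. by move=> C D CD; apply/setP => x; rewrite -!mem_fset_of CD. Qed.

Lemma fset_of_sub C : (fset_of C `<=` S)%fset.
Proof. by apply/fsubsetP => _ /imfsetP[x _ ->]; apply: valP. Qed.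

Lemma fset_ofS C D : (fset_of C `<=` fset_of D)%fset = (C \subset D).
Proof.
apply/fsubsetP/fintype.subsetP => CD x; first by rewrite -!mem_fset_of => /CD.
by case/imfsetP => y /= /CD yD ->; rewrite mem_fset_of.
Qed.

Lemma fset_ofP X : (X `<=` S)%fset -> exists C, X = fset_of C.
Proof.
move=> /fsubsetP XS; exists [set x : S | val x \in X]; apply/fsetP => x.
apply/idP/imfsetP => [xX|[y /= + ->]]; last by rewrite inE.
by exists [` XS x xX]%fset; rewrite /= ?inE.
Qed.

Lemma set_fset_of C : [set` fset_of C]%classic = [set val x | x in [set` C]]%classic.
Proof.
apply/seteqP; split=> [x /imfsetP[y /= yC ->]|_ [y /= yC <-]]; first by exists y.
by rewrite mem_fset_of.
Qed.

Lemma general_spanning C m : supported C m -> lincomb w m = homogenize z -> spanning w C.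
Proof.
move=> mC mz; apply: (spanning_homogenize mC mz) => -[]; rewrite -set_fset_of.
exact: zS (fset_of_sub C).
Qed.

(** Comparing heights, the coefficients sum to 1, so they are not all nonpositive. *)
Lemma homogenize_pointed m x : lincomb w m = w x -> exists y, 0 < m y.
Proof.
rewrite lincomb_homogenize => -[m1 _]; apply: contrapT => mneg.
have := @ltr01 R; rewrite -m1 ltNge sumr_le0 // => y _.
by rewrite leNgt; apply/negP => my; apply: mneg; exists y.
Qed.

Lemma z_containing_cone C : z_containing z (fset_of C) <-> cone C.
Proof. by rewrite /z_containing set_fset_of; apply: interior_cone general_spanning. Qed.

(** A minimal containing set equals any simplex inside it; conversely, a proper subset of a simplex
    has at most [d] points, too few to be containing. *)
Lemma min_containingE :
  min_containing z S = [fset fset_of C | C in simplices d cone [set: S]]%fset.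
Proof.
have cardC := con_card (in_cone_simplex (dim_homogenize R d) general_spanning).
apply/fsetP => X; rewrite !inE fpowersetE; apply/andP/imfsetP => /=.
  move=> [/fset_ofP[C ->] /asboolP[/z_containing_cone Ccone Cmin]]; exists C => //.
  have [D DC] := in_cone_simplex (dim_homogenize R d) general_spanning Ccone.
  have /simplicesP[DC' Dcone cD] := DC; apply/simplicesP; split; rewrite ?finset.subsetT //.
  suff -> : C = D by [].
  apply/eqP; rewrite eq_sym finset.eqEsubset DC' -fset_ofS; apply: contraT => CD.
  case: (Cmin (fset_of D)); last exact/z_containing_cone.
  by rewrite fproperE fset_ofS DC'.
move=> [C /simplicesP[_ Ccone cC] ->]; rewrite fset_of_sub; split=> //; apply/asboolP.
split; first exact/z_containing_cone.
move=> Y YC; have [|D YD] := @fset_ofP Y.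
  exact: fsubset_trans (fproper_sub YC) (fset_of_sub C).
rewrite {Y}YD fproperE !fset_ofS -fintype.properE in YC *.
move=> /z_containing_cone/cardC; apply/negP; rewrite -leqNgt -ltnS -cC.
exact: proper_card.
Qed.

(** By monotonicity of containment, maximality can be tested on the addition of single points. *)
Lemma max_avoidingE :
  max_avoiding z S = [fset fset_of C | C in avoiders cone [set: S]]%fset.
Proof.
apply/fsetP => X; rewrite !inE fpowersetE; apply/andP/imfsetP => /=.
  move=> [/fset_ofP[C ->] /asboolP[Cav Cmax]]; exists C => //.
  apply/avoidersP; split; rewrite ?finset.subsetT //.
    by apply/negP => /z_containing_cone.
  move=> s _ sC; apply/z_containing_cone; apply: contrapT => sav.
  apply: Cmax (fset_of_sub (s |: C)) _ sav.
  rewrite fproperE !fset_ofS -fintype.properE; apply/fintype.properP.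
  by split; [exact: finset.subsetU1|exists s; rewrite ?finset.setU11].
move=> [C /avoidersP[_ Cav Cmax] ->]; rewrite fset_of_sub; split=> //; apply/asboolP.
split; first by move=> /z_containing_cone; apply/negP.
move=> Y /fset_ofP[D ->]; rewrite fproperE !fset_ofS -fintype.properE => /fintype.properP[CD [s sD sC]].
apply; apply/z_containing_cone; apply: in_coneS (Cmax s (finset.in_setT _) sC).
by rewrite finset.subUset finset.sub1set sD.
Qed.

Lemma card_fset_of (F : {set {set S}}) : #|` [fset fset_of C | C in F]%fset| = #|F|.
Proof. by rewrite card_imfset /= ?cardE //; apply: fset_of_inj. Qed.

End Transfer.

(** * The four cardinality statements *)

Theorem theorem3p3 (R : realType) (d : nat)
    (S : {fset 'rV[R]_d}) (z : 'rV[R]_d) (zS : general_position z S) :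
  let a : int := #|` max_avoiding z S|%:Z in
  let c : int := #|` min_containing z S|%:Z in
  [/\ z_avoiding z S \/ (z_containing z S /\ #|` S| = d.+1) ->
        a = d%:Z * c + 1,
      a <= d%:Z * c + 1,
      z_containing z S -> #|` S| = d.+2 ->
        a = d%:Z * c - d%:Z + 1
    & z_containing z S -> (d.+3 <= #|` S|)%N ->
        a <= d%:Z * c - d%:Z].
Proof.
rewrite /= (max_avoidingE zS) (min_containingE zS) !card_fset_of.
set cone := in_cone _ _.
have dimE := dim_homogenize R d; have gen := general_spanning zS.
have simplexP := in_cone_simplex dimE gen.
have pivotP := in_cone_pivot dimE gen (@homogenize_pointed R d S).
have sideP := avoiders_opposite_sideP dimE gen.
have coneS : forall A B : {set S}, A \subset B -> cone A -> cone B.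
  exact: in_coneS.
have SE : S = fset_of [set: S].
  apply/fsetP => x; apply/idP/idP => [xS|/imfsetP[y _ ->]]; last exact: valP.
  by rewrite -[x]/(val [` xS]%fset) mem_fset_of inE.
have Scone := z_containing_cone zS [set: S]; rewrite -SE in Scone.
have cS : #|` S| = #|[set: S]| by rewrite cardsT cardfE.
rewrite cS; split.
- case=> [Sav|[/Scone Scon cT]].
    have {}Sav : ~~ cone [set: S] by apply/negP => /Scone.
    by have [-> ->] := avoiding_counts d coneS Sav; rewrite mulr0 add0r.
  by have [-> ->] := simplex_counts coneS simplexP Scon cT; rewrite mulr1 -addn1.
- rewrite -PoszM -PoszD lez_nat; exact: card_avoiders_le coneS simplexP sideP _.
- move=> /Scone Scon cT; rewrite (card_avoiders2 coneS simplexP pivotP Scon cT).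
  by rewrite (card_simplices2 simplexP pivotP Scon cT); lia.
- move=> /Scone Scon cT; have d_gt0 : (0 < d)%N.
    (* The space [R^0] has a single point, too few for [d + 3]. *)
    rewrite lt0n; apply/negP => /eqP d0; suff: (#|[set: S]| <= 1)%N by lia.
    apply/card_le1_eqP => x y _ _; apply: val_inj; apply/rowP => j.
    by exfalso; have := ltn_ord j; lia.
  rewrite lerBrDr -PoszM -PoszD lez_nat.
  exact: (card_avoiders_ge3 coneS simplexP pivotP sideP d_gt0 Scon cT).
Qed.
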